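(* Let $n \ge 1$ and let $\mathrm{Fl} = \{\mathrm{fl}_1,\dots,\mathrm{fl}_n\}$ be a tuple of functions which round to nearest in a perfect floating point system with unit roundoff $u$. If $20 n u \leq 1$ and $y_0,\dots,y_n \in \mathbb{R}$, then $$\left| \mathrm{Fl}\left(\sum_{k=0}^n y_k\right) - \sum_{k=0}^n y_k \right| \leq \frac{n u}{1 + n u} \sum_{k=0}^n |y_k|.$$
   Context: Let $\beta \ge 2$ be an integer (the base) and $\mu \ge 1$ an integer. The unit roundoff is $u := 1/(2\beta^{\mu})$. For $e\in\mathbb{Z}$ let $\mathcal{E}_e := \{\beta^e(\beta^\mu + r) : r = 0,1,\dots,(\beta-1)\beta^\mu - 1\}$. The perfect floating point system associated to $\beta,\mu$ is $\mathcal{P} := \{0\} \cup \bigcup_{e\in\mathbb{Z}} (\mathcal{E}_e \cup -\mathcal{E}_e)$. A function $\mathrm{fl}:\mathbb{R}\to\mathbb{R}$ rounds to nearest in a system $\mathcal{F}$ if for all $z\in\mathbb{R}$ one has $\mathrm{fl}(z)\in\mathcal{F}$ and $|\mathrm{fl}(z)-z|\le|x-z|$ for all $x\in\mathcal{F}$ (ties may be broken arbitrarily). A tuple $\mathrm{Fl}=\{\mathrm{fl}_1,\dots,\mathrm{fl}_n\}$ rounds to nearest in $\mathcal{F}$ if each $\mathrm{fl}_k$ does (the $\mathrm{fl}_k$ may differ). Floating point sum: for real $y_0,\dots,y_n$, put $\hat s_1 := \mathrm{fl}_1(y_0+y_1)$ and $\hat s_k := \mathrm{fl}_k(\hat s_{k-1}+y_k)$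 for $2\le k\le n$. Then $\mathrm{Fl}\left(\sum_{k=0}^n y_k\right) := \hat s_n$. *)

(* Defs.v *)
From mathcomp Require Import all_boot all_order all_algebra.
From mathcomp Require Import classical_sets reals.

Set Implicit Arguments.
Unset Strict Implicit.
Unset Printing Implicit Defensive.

Import Order.TTheory GRing.Theory Num.Theory.

Local Open Scope classical_set_scope.
Local Open Scope ring_scope.

Section FloatingPoint.
Variable R : realType.

Definition unit_roundoff (beta mu : nat) : R := 1 / (2 * beta%:R ^+ mu).

Definition binade (beta mu : nat) (e : int) : set R :=
  [set beta%:R ^ e * (beta%:R ^+ mu + r%:R)
     | r in [set r : nat | (r < (beta - 1) * beta ^ mu)%N]].

Definition perfect_system (beta mu : nat) : set R :=
  [set 0] `|`
  \bigcup_(e : int) (binade beta mu e `|` [set - x | x in binade beta mu e]).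

Definition rounds_to_nearest (F : set R) (fl : R -> R) : Prop :=
  forall z : R, F (fl z) /\ forall x : R, F x -> `|fl z - z| <= `|x - z|.

(* The recursion starts from y 0 unrounded, so that fl_sum fl y 1 is
   fl 1 (y 0 + y 1); the value fl 0 is never used. *)
Fixpoint fl_sum (fl : nat -> R -> R) (y : nat -> R) (n : nat) : R :=
  if n is k.+1 then fl k.+1 (fl_sum fl y k + y k.+1) else y 0%N.

End FloatingPoint.

Arguments unit_roundoff R beta mu : clear implicits.
Arguments perfect_system R beta mu : clear implicits.

(* Main.v *)
Require Import Defs.
From mathcomp Require Import all_boot all_order all_algebra.
From mathcomp Require Import classical_sets reals.
From mathcomp Require Import zify ring lra.

Import Order.TTheory GRing.Theory Num.Theory.

Local Open Scope ring_scope.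

(** Write [z_k] for the exact argument of the [k]-th rounding and [delta_k] for
    its rounding error.  The computed sum misses the exact one by the sum of
    the [delta_k], so it is enough to bound the sum of the [|delta_k|].

    Let [B] be the power of [beta] with [B <= max_k |z_k| < beta * B], and let
    [m] be the first index with [B <= |z_m|].  Three estimates hold:
    - for every [k], [|delta_k| <= u * B], because all the [|z_k|] are below
      [beta * B] (half the spacing of the grid, [rounding_error_half_ulp]);
    - for [k < m], [|z_k|] is even below [B], one binade lower, so that
      [|delta_k| <= u * B / beta <= u * B / 2];
    - for [k > m], also [|delta_k| <= |y_k|], because the previous partial sum
      is itself a floating point number and competes with the rounded value
      ([delta_le_summand]).
    At [m] itself the power [B] is a competitor ([rounding_error_le]), whence
    [B + |delta_m| <= |z_m|], while [|z_m|] is at most the sum of the absolute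
    values of the summands met so far plus the earlier errors.

    Let [a], [d], [c] be the parts of the sum of the [|delta_k|] over [k < m],
    [k = m], [k > m], and [T] the sum of all [|y_k|].  The estimates give
    [B + d - a + c <= T], so it suffices that
    [(1 + n u) (a + d + c) <= n u (B + d - a + c)], that is,
    [a + d + c + 2 n u a <= n u B].  The extra term [2 n u a] is at most [a], and
    doubling [a] is affordable: each error before [m] only uses half of the
    [u * B] that a step is entitled to ([error_budget]). *)

(** * Powers of the base *)

Lemma exists_floor_exponent (R : realType) (beta : nat) (x : R) :
  (2 <= beta)%N -> 0 < x ->
  exists e : int, beta%:R ^ e <= x < beta%:R ^ (e + 1).
Proof.
move=> hb x0.
have big (t : R) : 0 <= t -> exists N : nat, t < beta%:R ^+ N.
  move=> t0; exists (Num.Def.archi_bound t).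
  apply: lt_trans (archi_boundP t0) _.
  by rewrite -natrX ltr_nat ltn_expl.
(* Since [beta ^ (- M) < x], the least natural number [k]
   with [x < beta ^ (k - M)] is a successor. *)
have [N xN] := big x (ltW x0).
have [M xM] : exists M : nat, x^-1 < beta%:R ^+ M by apply: big; rewrite invr_ge0 ltW.
have exP : exists k : nat, x < beta%:R ^ (k%:Z - M%:Z).
  by exists (N + M)%N; rewrite PoszD addrK.
case: (ex_minnP exP) => -[|j] hj hmin.
  have : beta%:R ^ (- M%:Z) < x.
    by rewrite -invr_expz -[x]invrK ltf_pV2 ?posrE ?invr_gt0 ?exprn_gt0 ?ltr0n //; lia.
  by rewrite sub0r in hj => /(lt_trans hj); rewrite ltxx.
exists (j%:Z - M%:Z); apply/andP; split; last first.
  by have -> : j%:Z - M%:Z + 1 = j.+1%:Z - M%:Z by lia.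
by rewrite leNgt; apply/negP => /hmin; rewrite ltnn.
Qed.

(** * Rounding in a perfect system *)

Section PerfectSystem.
Variables (R : realType) (beta mu : nat).
Hypothesis hbeta : (2 <= beta)%N.

Let F := perfect_system R beta mu.
Let b : R := beta%:R.

Let b_gt0 : 0 < b. Proof. by rewrite /b ltr0n; lia. Qed.

Lemma perfect_systemN (x : R) : F x -> F (- x).
Proof.
case=> [->|[e _ [xe|[x' xe <-]]]]; first by left; rewrite oppr0.
- by right; exists e => //; right; exists x.
- by rewrite opprK; right; exists e => //; left.
Qed.

(** The right endpoint [q = beta ^ mu.+1] falls outside the binade of exponent
    [e]; it is the first element of the next one.  Including it makes both
    neighbours of any real of the binade available as competitors. *)
Lemma perfect_system_grid (e : int) (q : nat) :
  (beta ^ mu <= q <= beta ^ mu.+1)%N -> F (b ^ e * q%:R).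
Proof.
case/andP => q1; rewrite leq_eqVlt => /predU1P[->|q2].
- right; exists (e + 1) => //; left; exists 0%N.
    by rewrite /= muln_gt0 expn_gt0; lia.
  by rewrite addr0 natrX exprS expfzDr ?gt_eqF // expr1z mulrA.
- right; exists e => //; left; exists (q - beta ^ mu)%N.
    by move: q2; rewrite /= expnS mulnBl mul1n; lia.
  by rewrite -natrX -natrD subnKC.
Qed.

Variable fl : R -> R.
Hypothesis hfl : rounds_to_nearest F fl.

(** The system is symmetric, so a competitor for [|z|] gives one for [z]:
    in this form the sign of [z] never has to be considered again. *)
Lemma rounding_error_le (z x : R) : F x -> `|fl z - z| <= `|x - `|z| |.
Proof.
move=> Fx; have [_ near] := hfl z.
have [z0|z0] := ger0P z; first exact: near.
apply: le_trans (near _ (perfect_systemN _ Fx)) _.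
by rewrite -normrN opprD !opprK.
Qed.

(** In its own binade [z] lies between two consecutive multiples of the grid
    spacing, one of which is within half that spacing; lower binades have
    smaller spacing.  Only an upper bound on [|z|] is assumed, so that one
    exponent serves all the steps of a summation. *)
Lemma rounding_error_half_ulp (e : int) (z : R) :
  `|z| < b ^ e * b ^+ mu.+1 -> `|fl z - z| <= b ^ e / 2.
Proof.
move=> ze.
have [->|z0] := eqVneq z 0.
  have F0 : F 0 by left.
  apply: le_trans (rounding_error_le 0 0 F0) _.
  by rewrite normr0 subrr normr0 divr_ge0 ?exprz_ge0 // ltW.
have [e1 /andP[lo hi]] : exists e1 : int, b ^ e1 * b ^+ mu <= `|z| < b ^ e1 * b ^+ mu.+1.
  have z_gt0 : 0 < `|z| by rewrite normr_gt0.
  have [E /andP[lo hi]] := exists_floor_exponent R beta `|z| hbeta z_gt0.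
  exists (E - mu%:Z); rewrite !exprnP -!expfzDr ?gt_eqF // subrK lo /=.
  by have -> : E - mu%:Z + mu.+1%:Z = E + 1 by lia.
have h0 : 0 < b ^ e1 by rewrite exprz_gt0.
have e1e : b ^ e1 <= b ^ e.
  have := le_lt_trans lo ze; rewrite !exprnP -!expfzDr ?gt_eqF //.
  have b1 : 1 < b by rewrite /b ltr1n.
  by rewrite ltr_eXz2l // => le_exp; rewrite ler_eXz2l //; lia.
apply: (@le_trans _ _ (b ^ e1 / 2)); last by lra.
(* The two grid neighbours of [|z|] are [q] and [q.+1] times [b ^ e1]. *)
pose q := Num.truncn (`|z| / b ^ e1).
have /truncn_itv /andP[] : 0 <= `|z| / b ^ e1 by rewrite divr_ge0 // ltW.
rewrite -/q ler_pdivlMr // ltr_pdivrMr // => qlo qhi.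
have q1 : (beta ^ mu <= q)%N.
  rewrite -ltnS -(ltr_nat R) natrX -/b.
  by rewrite -(ltr_pM2l h0) (le_lt_trans lo) // mulrC.
have q2 : (q < beta ^ mu.+1)%N.
  rewrite -(ltr_nat R) natrX -/b.
  by rewrite -(ltr_pM2l h0) (le_lt_trans _ hi) // mulrC.
have dlo : `|fl z - z| <= `|b ^ e1 * q%:R - `|z| |.
  by apply: rounding_error_le; apply: perfect_system_grid; lia.
have dhi : `|fl z - z| <= `|b ^ e1 * q.+1%:R - `|z| |.
  by apply: rounding_error_le; apply: perfect_system_grid; lia.
rewrite -natr1 in dhi qhi.
have dlo' : `|fl z - z| <= `|z| - b ^ e1 * q%:R.
  by move: dlo; rewrite [X in _ <= X -> _]ler0_norm ?opprB // subr_le0 mulrC.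
have dhi' : `|fl z - z| <= b ^ e1 * (q%:R + 1) - `|z|.
  by move: dhi; rewrite [X in _ <= X -> _]ger0_norm // subr_ge0 mulrC ltW.
by move: dlo' dhi'; lra.
Qed.

End PerfectSystem.

(** * Recursive summation *)

(** The final arithmetic: [a], [d] and [c] are the errors committed before,
    at and after step [m], and [S], [Y] are the absolute sums of the summands
    used up to step [m] and after it. *)
Lemma error_budget (R : realFieldType) (n m : nat) (u B a d c S Y : R) :
  (m < n)%N -> 0 <= u -> 2 * n%:R * u <= 1 -> 0 <= a ->
  a <= m%:R * (u * B / 2) -> d <= u * B ->
  c <= (n - m.+1)%:R * (u * B) -> c <= Y -> B + d <= S + a ->
  a + d + c <= n%:R * u / (1 + n%:R * u) * (S + Y).
Proof.
move=> mn u0 nu1 a0 am dB cB cY hS.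
rewrite natrB // -natr1 in cB.
have t0 : 0 <= n%:R * u by rewrite mulr_ge0.
set t := n%:R * u in nu1 t0 *.
have t1 : 2 * t <= 1 by rewrite /t mulrA.
rewrite mulrAC ler_pdivlMr; last by lra.
have hSY : t * (B + d - a + c) <= t * (S + Y) by apply: ler_wpM2l => //; lra.
have ta : 2 * t * a <= a by rewrite ler_piMl.
have tB : t * B = m%:R * (u * B) + (n%:R - (m%:R + 1)) * (u * B) + u * B.
  by rewrite /t; ring.
have : t * (B + d - a + c) = t * B + t * (a + d + c) - 2 * t * a by ring.
lra.
Qed.

Section RecursiveSummation.
Variables (R : realType) (beta mu : nat).
Hypothesis hbeta : (2 <= beta)%N.
Variables (n : nat) (fl : nat -> R -> R).
Hypothesis hfl : forall k : nat, (1 <= k <= n)%N ->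
  rounds_to_nearest (perfect_system R beta mu) (fl k).
Variable y : nat -> R.

Let b : R := beta%:R.
Let u : R := unit_roundoff R beta mu.
(* Steps are numbered from 0: step [k] adds [y k.+1] and rounds with [fl k.+1]. *)
Let s := fl_sum fl y.
Let z k := s k + y k.+1.
Let delta k := s k.+1 - z k.

Let b_gt0 : 0 < b. Proof. by rewrite /b ltr0n; lia. Qed.

Lemma fl_sum_decomposition (j : nat) :
  s j = \sum_(0 <= k < j.+1) y k + \sum_(0 <= k < j) delta k.
Proof.
elim: j => [|j IH]; first by rewrite big_nat1 big_geq // addr0.
rewrite [in RHS]big_nat_recr //= [X in _ = _ + X]big_nat_recr //=.
by rewrite addrACA -IH /delta /z; ring.
Qed.

(** For [k > 0] the partial sum [s k] is a rounded value, hence a competitor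
    for the rounding of [s k + y k.+1].  This fails for [k = 0], since [y 0] is
    not rounded. *)
Lemma delta_le_summand (k : nat) : (0 < k < n)%N -> `|delta k| <= `|y k.+1|.
Proof.
case: k => // k kn.
have [Fs _] := hfl k.+1 ltac:(lia) (z k).
have [_ near] := hfl k.+2 ltac:(lia) (z k.+1).
apply: le_trans (near _ Fs) _.
by rewrite -normrN /z opprB addrAC subrr add0r.
Qed.

Lemma abs_rounded_argument_le (j : nat) :
  `|z j| <= \sum_(0 <= k < j.+2) `|y k| + \sum_(0 <= k < j) `|delta k|.
Proof.
rewrite /z fl_sum_decomposition addrAC -big_nat_recr //=.
by apply: le_trans (ler_normD _ _) _; apply: lerD; apply: ler_norm_sum.
Qed.

Lemma fl_sum_error : 2 * n%:R * u <= 1 ->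
  `|s n - \sum_(0 <= k < n.+1) y k| <=
    n%:R * u / (1 + n%:R * u) * \sum_(0 <= k < n.+1) `|y k|.
Proof.
move=> nu1.
have u0 : 0 < u by rewrite /u /unit_roundoff divr_gt0 ?mulr_gt0 ?exprn_gt0.
rewrite fl_sum_decomposition addrC addKr.
apply: le_trans (ler_norm_sum _ _ _) _.
(* If all the [z k] vanish there is no exponent to choose, but 0 is rounded exactly. *)
have [/existsP[i0 zi0]|] := boolP [exists i : 'I_n, z i != 0]; last first.
  rewrite negb_exists => /forallP z0.
  rewrite big_nat big1 => [|k /= kn].
    have nu0 : 0 <= n%:R * u by rewrite mulr_ge0 // ltW.
    by apply: mulr_ge0; [rewrite divr_ge0 // addr_ge0|exact: sumr_ge0].
  have /eqP zk : z k == 0 by have := z0 (Ordinal kn); rewrite negbK.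
  have [_ near] := hfl k.+1 ltac:(lia) (z k).
  apply/eqP; rewrite -normr_le0 normr_id; apply: le_trans (near 0 _) _; first by left.
  by rewrite zk subrr normr0.
pose zmax := `|z [arg max_(i > i0) `|z i|]%O|.
have zle k : (k < n)%N -> `|z k| <= zmax.
  by move=> kn; rewrite /zmax; case: arg_maxP => // i _ /(_ (Ordinal kn)); exact.
have zmax0 : 0 < zmax by rewrite (lt_le_trans _ (zle i0 _)) ?normr_gt0.
have [E /andP[lo hi]] := exists_floor_exponent R beta zmax hbeta zmax0.
(* [e] is the exponent of the grid spacing in the binade that starts at [b ^ E]. *)
pose e := E - mu%:Z.
have Be : b ^ e * b ^+ mu = b ^ E by rewrite /e exprnP -expfzDr ?gt_eqF // subrK.
pose B := b ^ E; have B0 : 0 < B by rewrite exprz_gt0.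
have uB : b ^ e / 2 = u * B.
  rewrite /B -Be /u /unit_roundoff -/b; field.
  by rewrite expf_neq0 // gt_eqF.
have dB k : (k < n)%N -> `|delta k| <= u * B.
  move=> kn; rewrite -uB.
  apply: (rounding_error_half_ulp _ _ _ hbeta _ (hfl k.+1 _)); first lia.
  apply: le_lt_trans (zle _ kn) _; rewrite -/b exprSr mulrA Be.
  by move: hi; rewrite -/b expfzDr ?gt_eqF // expr1z.
have dB2 k : (k < n)%N -> `|z k| < B -> `|delta k| <= u * B / 2.
  move=> kn zk; apply: (@le_trans _ _ (b ^ (e - 1) / 2)).
    apply: (rounding_error_half_ulp _ _ _ hbeta _ (hfl k.+1 _)); first lia.
    by rewrite -/b exprS mulrA -[X in _ * X * _]expr1z -expfzDr ?gt_eqF // subrK Be.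
  rewrite -uB expfzDr ?gt_eqF // -mulrA -[_ / 2 / 2]mulrA ler_pM2l ?exprz_gt0 //.
  rewrite ler_pM2r ?invr_gt0 // exprN1 lef_pV2 ?posrE //.
  by rewrite /b ler_nat.
have exm : exists k, (k < n)%N && (B <= `|z k|).
  by exists [arg max_(i > i0) `|z i|]%O; rewrite ltn_ord; exact: lo.
case: (ex_minnP exm) => m /andP[mn Bm] hmin.
have dm : `|delta m| <= `|z m| - B.
  rewrite -(ger0_norm (_ : 0 <= `|z m| - B)) ?subr_ge0 // [X in _ <= X]distrC.
  apply: (rounding_error_le _ _ _ _ (hfl m.+1 _)); first lia.
  rewrite /B -Be /b -natrX; apply: perfect_system_grid => //.
  by rewrite leqnn leq_exp2l // leqnSn.
have split_y : \sum_(0 <= k < n.+1) `|y k| =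
    \sum_(0 <= k < m.+2) `|y k| + \sum_(m.+1 <= k < n) `|y k.+1|.
  by rewrite (@big_cat_nat _ _ _ m.+2) //= [X in _ + X]big_add1.
rewrite split_y (@big_cat_nat _ _ _ m) //=; last exact: ltnW.
rewrite [X in _ + X]big_ltn // addrA.
apply: (@error_budget _ _ m _ B) => //.
- exact: ltW.
- by apply: sumr_ge0.
- rewrite -[m in m%:R]subn0 mulr_natl -sumr_const_nat; apply: ler_sum_nat => k /andP[_ km].
  apply: dB2; first lia.
  by rewrite ltNge; apply/negP => Bk; have := hmin k; rewrite Bk; lia.
- exact: dB.
- by rewrite mulr_natl -sumr_const_nat; apply: ler_sum_nat => k /andP[_ kn]; apply: dB.
- by apply: ler_sum_nat => k /andP[mk kn]; apply: delta_le_summand; lia.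
- by move: dm (abs_rounded_argument_le m); lra.
Qed.

End RecursiveSummation.

Theorem lemma5 (R : realType) (beta mu : nat)
    (hbeta : (2 <= beta)%N) (hmu : (1 <= mu)%N)
    (n : nat) (hn : (1 <= n)%N) (fl : nat -> R -> R)
    (hfl : forall k : nat, (1 <= k <= n)%N ->
       rounds_to_nearest (perfect_system R beta mu) (fl k))
    (u : R) (hu : u = unit_roundoff R beta mu)
    (hnu : 20 * n%:R * u <= 1) (y : nat -> R) :
  `|fl_sum fl y n - \sum_(0 <= k < n.+1) y k| <=
    n%:R * u / (1 + n%:R * u) * \sum_(0 <= k < n.+1) `|y k|.
Proof.
rewrite hu; apply: (fl_sum_error _ _ _ hbeta _ _ hfl); rewrite -hu.
have : 0 <= n%:R * u.
  by rewrite hu mulr_ge0 // divr_ge0 // mulr_ge0 // exprn_ge0.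
by move: hnu; rewrite -!mulrA; lra.
Qed.
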